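(* Let $n=m^2$ for a positive integer $m$. Every nondeterministic OBDD (NOBDD) computing $\mathtt{notPERM}_n$ has width at least $\sqrt{n}-\frac{5}{4}\log_2 n-1$.
   Context: For $n=m^2$, inputs $\sigma\in\{0,1\}^n$ have bits indexed $x_{1,1},\dots,x_{1,m},\dots,x_{m,1},\dots,x_{m,m}$ and define the $m\times m$ 0-1 matrix $A(\sigma)$ with $(i,j)$ entry $x_{i,j}$. $\mathtt{notPERM}_n(\sigma)=0$ if $A(\sigma)$ is a permutation matrix, and $1$ otherwise. An OBDD on variables $x_1,\dots,x_n$ is a directed acyclic graph with one source whose nodes are partitioned into levels $V_0,\dots,V_\ell$; the nodes of $V_\ell$ are sinks, each accepting or rejecting; all nodes of a level $V_j$ ($j<\ell$) query the same variable and have outgoing edges labelled 0 and 1 only to nodes of $V_{j+1}$; each variable is queried at most once on every source-to-sink path. In a nondeterministic OBDD (NOBDD) a node may have several outgoing edges with the same label, and an input is accepted iff at least one computation path consistent with it reaches an accepting sink. It computes $f$ if it accepts exactly the inputs in $f^{-1}(1)$. The width is $\max_j|V_j|$. *)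

(* Defs.v *)
From HB Require Import structures.
From mathcomp Require Import all_boot all_order all_algebra.
From mathcomp Require Import reals exp.

Set Implicit Arguments.
Unset Strict Implicit.
Unset Printing Implicit Defensive.

Import Order.TTheory GRing.Theory Num.Theory.

(* A node of the last level queries nothing. *)
Definition query_of n depth (query : 'I_depth -> 'I_n) (j : 'I_depth.+1) :
  option 'I_n := omap query (insub (val j)).

(* [edge b u v]: there is an edge from u to v labelled b. A node may have any *)
(* number of outgoing edges with a given label, possibly none, in which case  *)
(* a computation gets stuck without accepting. Levels are the blocks of a     *)
(* partition, hence nonempty. Acyclicity follows from [edge_level], and the   *)
(* source, being the only node without incoming edge, forms level 0 alone.    *)
Record nobdd (n : nat) := Nobdd {
  depth : nat;
  node : finType;
  level : node -> 'I_depth.+1;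
  query : 'I_depth -> 'I_n;
  edge : bool -> rel node;
  source : node;
  accepting : {set node};
  level_nonempty : forall j, exists v, level v = j;
  edge_level : forall b u v, edge b u v -> level v = (level u).+1 :> nat;
  one_source : forall v, (forall b u, ~~ edge b u v) <-> v = source;
  accepting_sink : forall v, v \in accepting -> level v = ord_max;
  read_once : forall p : seq node,
    path (fun u v => edge false u v || edge true u v) source p ->
    level (last source p) = ord_max ->
    uniq (pmap (fun v => query_of query (level v)) (source :: p))
}.

Section Semantics.
Variables (n : nat) (P : nobdd n).

Definition step (s : n.-tuple bool) (u v : node P) : bool :=
  if query_of (@query n P) (level u) is Some i then edge (tnth s i) u v
  else false.

Definition accepts (s : n.-tuple bool) : Prop :=
  exists2 p : seq (node P),
    path (step s) (source P) p & last (source P) p \in accepting P.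

Definition computes (f : n.-tuple bool -> bool) : Prop :=
  forall s, accepts s <-> f s = true.

Definition width : nat := \max_j #|[set v : node P | level v == j]|.

End Semantics.

(* [mxvec_index i j] is the row-major position of (i, j), and m ^ 2 is        *)
(* convertible to m * m.                                                      *)
Definition input_mx m (s : (m ^ 2).-tuple bool) : 'M[int]_m :=
  (\matrix_(i, j) (tnth s (mxvec_index i j))%:R)%R.

Definition notPERM m (s : (m ^ 2).-tuple bool) : bool :=
  ~~ is_perm_mx (input_mx s).

Definition log2 (R : realType) (x : R) : R := (ln x / ln 2)%R.

(* Main.v *)
(* For a permutation p, consider the rows whose 1 is queried among the first  *)
(* t levels. If two permutations p, q have the same set of nodes reachable at *)
(* level t, then so do the inputs glued from the early part of p and the late *)
(* part of q, hence this hybrid is again a permutation matrix; so p and q     *)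
(* agree on the set of early rows and on its image. At most k! (m - k)!       *)
(* permutations share given such sets of size k, and there are at most        *)
(* 2 ^ width reachable sets per level. Every permutation has exactly k early  *)
(* rows at one of at most m ^ 2 levels, whence C(m, k) <= m ^ 2 * 2 ^ width;  *)
(* take k = m / 2 and 4 ^ m <= 4 m C(m, m / 2) ^ 2.                           *)
Require Import Defs.
From mathcomp Require Import all_boot all_order all_algebra.
From mathcomp Require Import all_fingroup.
From mathcomp Require Import reals exp.
From mathcomp Require Import zify ring lra.

Set Implicit Arguments.
Unset Strict Implicit.
Unset Printing Implicit Defensive.

Import Order.TTheory GRing.Theory Num.Theory.

(** From level t on, acceptance depends only on the set of nodes reachable there and on the bits
    read later, and a level offers at most [2 ^ width P] such sets. If two permutations share the
    set at level t, gluing early bits of one to late bits of the other gives an input that is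
    rejected as well, hence again a permutation matrix ([hybrid_perm]). By [reach_perm_inj] the set
    therefore determines the early rows and their image. At most k! (m - k)! permutations send one
    given k-set onto another, so each level accounts for at most 2 ^ width k! (m - k)! permutations
    with k early rows. The number of early rows climbs from 0 to m by steps of at most one, so all
    m! permutations are counted at some level: this is [bin_le_width]. Taking k = m / 2 and
    [half_bin_lower] gives [exp_le_width], whose logarithm is the theorem. *)

(** * Reachable sets: the subset construction on levels *)

Section Reachability.
Variables (n : nat) (P : nobdd n).
Implicit Types (s : n.-tuple bool) (t : nat) (u v : node P).

Fixpoint reach s t : {set node P} :=
  if t is t'.+1 then [set v | [exists u in reach s t', step s u v]]
  else [set source P].

Lemma reachP s t v :
  reflect (exists p, [/\ size p = t, path (step s) (source P) p
                       & last (source P) p = v])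
          (v \in reach s t).
Proof.
apply: (iffP idP).
  elim: t v => [|t IHt] v /=; rewrite inE.
    by move/eqP->; exists [::].
  case/existsP=> u /andP[/IHt[p [sz_p path_p last_p]] uv].
  by exists (rcons p v); rewrite size_rcons sz_p rcons_path last_rcons last_p path_p.
case=> p [<- + <-]; elim/last_ind: p => [|p u IHp] /=; first by rewrite inE.
rewrite rcons_path last_rcons size_rcons => /andP[/IHp in_p st].
by rewrite inE; apply/existsP; exists (last (source P) p); rewrite in_p.
Qed.

Lemma level_source : level (source P) = ord0.
Proof.
have [v lv] := level_nonempty (ord0 : 'I_(depth P).+1).
(* A node of level 0 has no incoming edge, so it is the source. *)
suff <- : v = source P by [].
by apply/one_source => b u; apply/negP => /edge_level; rewrite lv.
Qed.

Lemma step_level s u v : step s u v -> level v = (level u).+1 :> nat.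
Proof. by rewrite /step; case: query_of => // i /edge_level. Qed.

Lemma reach_level s t v : v \in reach s t -> level v = t :> nat.
Proof.
elim: t v => [|t IHt] v /=; rewrite inE; first by move/eqP->; rewrite level_source.
by case/existsP=> u /andP[/IHt lu /step_level]; rewrite lu.
Qed.

Lemma acceptsP s :
  accepts P s <-> exists2 v, v \in reach s (depth P) & v \in accepting P.
Proof.
split=> [[p path_p acc]|[v /reachP[p [_ path_p <-]] acc]]; last by exists p.
exists (last (source P) p) => //.
have in_p : last (source P) p \in reach s (size p) by apply/reachP; exists p.
have := reach_level in_p; rewrite (accepting_sink acc) /= => sz_p.
by rewrite sz_p.
Qed.

Lemma query_of_level (j : 'I_(depth P)) (l : 'I_(depth P).+1) :
  val l = j -> query_of (@query n P) l = Some (query j).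
Proof. by rewrite /query_of => ->; rewrite valK. Qed.

Definition queried_before t : {set 'I_n} := [set query j | j : 'I_(depth P) & j < t].

Lemma eq_step s s' (j : 'I_(depth P)) u v :
  level u = j :> nat -> tnth s (query j) = tnth s' (query j) ->
  step s u v = step s' u v.
Proof. by move=> lu eq_s; rewrite /step (query_of_level lu) eq_s. Qed.

(** A step out of level j reads only the bit at [query j], so equal reachable sets stay equal while
    the bits read agree. *)
Lemma eq_reach_from s s' t0 t : t0 <= t <= depth P -> reach s t0 = reach s' t0 ->
  (forall j : 'I_(depth P), t0 <= j < t -> tnth s (query j) = tnth s' (query j)) ->
  reach s t = reach s' t.
Proof.
elim: t => [|t IHt] /andP[le_t t_le] eq0 eq_s.
  by move: le_t eq0; rewrite leqn0 => /eqP->.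
move: le_t; rewrite leq_eqVlt => /predU1P[eqt|le_t]; first by rewrite -eqt.
have eqt : reach s t = reach s' t.
  apply: IHt => // [|j /andP[j1 j2]]; first by rewrite -ltnS le_t ltnW.
  by apply: eq_s; rewrite j1 ltnS ltnW.
apply/setP=> v /=; rewrite !inE eqt; apply: eq_existsb => u.
case: (boolP (u \in _)) => //= /reach_level lu.
apply: (@eq_step _ _ (Ordinal t_le)) => //; apply: eq_s => /=.
by rewrite -ltnS le_t ltnSn.
Qed.

Lemma eq_reach s s' t : t <= depth P ->
  {in queried_before t, tnth s =1 tnth s'} -> reach s t = reach s' t.
Proof.
move=> t_le eq_s; apply: (@eq_reach_from _ _ 0) => // j j_lt.
by apply: eq_s; apply/imsetP; exists j; rewrite ?inE.
Qed.

Lemma eq_accepts s s' :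
  reach s (depth P) = reach s' (depth P) -> accepts P s <-> accepts P s'.
Proof.
by move=> eq_s; split=> /acceptsP acc; apply/acceptsP; rewrite ?eq_s // -eq_s.
Qed.

(** [read_once] only constrains source-to-sink paths; an accepting path is one, and it visits every
    level. *)
Lemma query_inj s : accepts P s -> injective (@query n P).
Proof.
case=> p path_p /accepting_sink last_p; apply/injectiveP.
have path_e : path (fun u v => edge false u v || edge true u v) (source P) p.
  apply: sub_path path_p => u v; rewrite /step; case: query_of => // i.
  by case: (tnth _ _) => ->; rewrite ?orbT.
have := read_once path_e last_p.
have lev u q : path (step s) u q ->
    [seq val (level v) | v <- u :: q] = iota (level u) (size q).+1.
  elim: q u => [|v q IHq] u // /andP[/step_level uv /IHq IH].
  by rewrite map_cons IH uv.
have sz_p : size p = depth P.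
  rewrite -[RHS](congr1 val last_p); apply/esym/(@reach_level s).
  by apply/reachP; exists p.
pose g k := omap (@query n P) (insub k).
have -> : pmap (fun v => query_of (@query n P) (level v)) (source P :: p)
    = pmap g [seq val (level v) | v <- source P :: p].
  by elim: (source P :: p) => //= v q ->.
have -> : [seq val (level v) | v <- source P :: p] = iota 0 (depth P + 1).
  by rewrite (lev _ _ path_p) level_source sz_p addn1.
(* The last level queries nothing and drops out of the list. *)
rewrite iotaD pmap_cat /= {2}/g insubF ?ltnn // cats0.
have -> : pmap g (iota 0 (depth P)) = map (@query n P) (ord_enum (depth P)).
  rewrite /ord_enum; elim: iota => //= k r ->.
  by rewrite /g; case: insub.
by rewrite /injectiveb /dinjectiveb enumT unlock.
Qed.

Lemma card_reach_sets (I : finType) (f : I -> n.-tuple bool) (A : {set I}) t :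
  t <= depth P -> #|[set reach (f i) t | i in A]| <= 2 ^ width P.
Proof.
rewrite -ltnS => t_lt; pose j := Ordinal t_lt.
apply: (@leq_trans #|powerset [set v : node P | level v == j]|).
  apply/subset_leq_card/subsetP=> _ /imsetP[s _ ->]; rewrite inE.
  by apply/subsetP=> v /reach_level lv; rewrite inE -val_eqE /= lv.
rewrite card_powerset leq_exp2l //.
exact: (leq_bigmax (F := fun j => #|[set v : node P | level v == j]|)).
Qed.

End Reachability.

(** * Intermediate values, and permutations between two given sets *)

Lemma discrete_ivt (f : nat -> nat) (k n : nat) :
  (forall t, f t.+1 <= (f t).+1) -> f 0 <= k <= f n ->
  exists2 t, t <= n & f t = k.
Proof.
move=> f_step; elim: n => [|n IHn] /andP[f0 fn].
  by exists 0 => //; apply/eqP; rewrite eqn_leq f0.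
have [le_k|lt_k] := leqP k (f n).
  by case: IHn => [|t t_le]; [rewrite f0 | exists t => //; apply: ltnW].
by exists n.+1 => //; apply/eqP; rewrite eqn_leq fn (leq_trans (f_step n)).
Qed.

(** A permutation stabilizing A is determined by its restrictions to A and to the complement. *)
Lemma card_perm_stab_le (T : finType) (A : {set T}) :
  #|[set p : {perm T} | p @: A == A]| <= #|A|`! * (#|~: A|)`!.
Proof.
rewrite -!card_perm -cardX.
pose f (p : {perm T}) := (restr_perm A p, restr_perm (~: A) p).
rewrite -(card_in_imset (f := f)).
  apply/subset_leq_card/subsetP=> _ /imsetP[p _ ->].
  by apply/andP; split; apply: restr_perm_on.
have stab (p : {perm T}) : p @: A = A ->
    (p \in 'N(A | 'P))%g /\ (p \in 'N(~: A | 'P))%g.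
  move=> stab_p; have pA : (p \in 'N(A | 'P))%g.
    by apply/astabsP => x; rewrite /= apermE -{1}stab_p mem_imset //; apply: perm_inj.
  by rewrite astabsC.
move=> p q; rewrite !inE => /eqP/stab[pA pC] /eqP/stab[qA qC] [eqA eqC].
apply/permP=> x; have [xA|xC] := boolP (x \in A).
  by rewrite -(restr_permE pA xA) eqA restr_permE.
rewrite -in_setC in xC.
by rewrite -(restr_permE pC xC) eqC restr_permE.
Qed.

(** Composing with the inverse of one such permutation injects the set into the stabilizer of A. *)
Lemma card_perm_imset_le (T : finType) (A B : {set T}) :
  #|[set p : {perm T} | p @: A == B]| <= #|A|`! * (#|~: A|)`!.
Proof.
have [->|[q]] := set_0Vmem [set p : {perm T} | p @: A == B]; first by rewrite cards0.
rewrite inE => /eqP qAB; apply: leq_trans (card_perm_stab_le A).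
rewrite -(card_imset _ (mulIg q^-1)%g).
apply/subset_leq_card/subsetP=> _ /imsetP[p + ->]; rewrite !inE => /eqP pAB.
apply/eqP.
have -> : (p * q^-1)%g @: A = (q^-1)%g @: (p @: A).
  by rewrite -imset_comp; apply: eq_imset => x; rewrite permM.
by rewrite pAB -qAB -imset_comp -[RHS]imset_id; apply: eq_imset => x /=; rewrite permK.
Qed.

(** * Lower bounds on central binomial coefficients *)

Lemma central_bin_even k : 'C(2 * k.+1, k.+1) = 2 * 'C(2 * k + 1, k).
Proof.
have := mul_bin_diag (2 * k.+1) k.
have -> : (2 * k.+1).-1 = 2 * k + 1 by lia.
by nia.
Qed.

Lemma central_bin_odd k : k.+1 * 'C(2 * k + 1, k) = (2 * k + 1) * 'C(2 * k, k).
Proof.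
have := mul_bin_down (2 * k + 1) k.
have -> : (2 * k + 1).-1 = 2 * k by lia.
have -> : 2 * k + 1 - k = k.+1 by lia.
by move->.
Qed.

Lemma central_bin_lower k : 0 < k -> 4 ^ (2 * k) <= 4 * k * 'C(2 * k, k) ^ 2.
Proof.
case: k => // k _; elim: k => // k IHk.
have := central_bin_odd k.+1; rewrite (central_bin_even k.+1).
move: IHk; set c := 'C(2 * k.+1, k.+1); set d := 'C(_, _) => IHk eq_d.
have -> : 4 ^ (2 * k.+2) = 16 * 4 ^ (2 * k.+1) by rewrite (mulnS _ k.+1) expnD.
move: IHk; set e := 4 ^ _ => IHk.
(* The factor [k.+2] clears the denominator in [eq_d]; what remains is 4 (k + 1) (k + 2) <= (2 k +
   3) ^ 2. *)
have : k.+2 * (16 * e) <= k.+2 * (4 * k.+2 * (2 * d) ^ 2).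
  have -> : k.+2 * (4 * k.+2 * (2 * d) ^ 2) = 16 * (k.+2 * d) ^ 2 by ring.
  rewrite eq_d; apply: (@leq_trans (k.+2 * (16 * (4 * k.+1 * c ^ 2)))).
    by rewrite leq_pmul2l // leq_pmul2l.
  have -> : k.+2 * (16 * (4 * k.+1 * c ^ 2)) = 16 * (4 * k.+1 * k.+2) * c ^ 2 by ring.
  have -> : 16 * ((2 * k.+1 + 1) * c) ^ 2 = 16 * (2 * k.+1 + 1) ^ 2 * c ^ 2 by ring.
  by rewrite leq_mul2r leq_mul2l; apply/orP; right; lia.
by rewrite leq_pmul2l.
Qed.

Lemma half_bin_lower m : 0 < m -> 4 ^ m <= 4 * m * 'C(m, m./2) ^ 2.
Proof.
move=> m_gt0; set k := m./2; have [m_odd|m_even] := boolP (odd m).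
  have em : m = 2 * k + 1 by lia.
  (* For odd m the middle coefficient is half of the next central one. *)
  have := @central_bin_lower k.+1 isT; rewrite central_bin_even mulnS expnD em.
  set e := 4 ^ (2 * k); set d := 'C(_, _) => le_e.
  by rewrite expnD -/e; nia.
have em : m = 2 * k by lia.
by rewrite em; apply: leq_trans (central_bin_lower _) _; nia.
Qed.

(** * Union and fiber bounds *)

Lemma card_bigcup_le (I T : finType) (F : I -> {set T}) (c : nat) :
  (forall i, #|F i| <= c) -> #|\bigcup_i F i| <= #|I| * c.
Proof.
move=> F_le; rewrite -sum_nat_const.
apply: (big_ind2 (fun (A : {set T}) s => #|A| <= s)); first by rewrite cards0.
  by move=> A a B b Aa Bb; apply: leq_trans (leq_card_setU _ _) (leq_add Aa Bb).
by move=> i _; apply: F_le.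
Qed.

Lemma card_fibers_le (T T' : finType) (f : T -> T') (A : {set T}) (c : nat) :
  (forall y, #|[set x in A | f x == y]| <= c) -> #|A| <= #|f @: A| * c.
Proof.
move=> f_le; rewrite -sum1_card (partition_big_imset f) -sum_nat_const.
apply: leq_sum => y _; apply: leq_trans (f_le y).
by rewrite -sum1_card; under [leqRHS]eq_bigl => x do rewrite inE.
Qed.

(** * Inputs encoding permutation matrices *)

Lemma notPERMPn m (s : (m ^ 2).-tuple bool) :
  reflect (exists r : 'S_m, forall i j, tnth s (mxvec_index i j) = (r i == j))
          (~~ notPERM s).
Proof.
rewrite negbK; apply: (iffP (is_perm_mxP _)) => -[r Er]; exists r.
  move=> i j; have /matrixP/(_ i j) := Er; rewrite !mxE.
  by case: (tnth _ _); case: eqP.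
by apply/matrixP=> i j; rewrite !mxE Er.
Qed.

Definition perm_input m (p : 'S_m) : (m ^ 2).-tuple bool :=
  [tuple [exists i, x == mxvec_index i (p i)] | x < m ^ 2].

Lemma mxvec_index_inj m n : injective (fun ij : 'I_m * 'I_n => mxvec_index ij.1 ij.2).
Proof. by move=> [i j] [i' j'] /cast_ord_inj/enum_rank_inj. Qed.

Lemma tnth_perm_input m (p : 'S_m) i j :
  tnth (perm_input p) (mxvec_index i j) = (p i == j).
Proof.
rewrite tnth_mktuple; apply/existsP/eqP => [[i' /eqP eq_ij]|<-]; last by exists i.
by have [-> ->] := @mxvec_index_inj m m (i, j) (i', p i') eq_ij.
Qed.

Lemma perm_inputF m (p : 'S_m) : ~~ notPERM (perm_input p).
Proof. by apply/notPERMPn; exists p => i j; rewrite tnth_perm_input. Qed.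

(** * The hybrid argument and the count of permutations *)

Section NotPERM.
Variables (m : nat) (P : nobdd (m ^ 2)).
Hypotheses (m_gt0 : 0 < m) (P_notPERM : computes P (@notPERM m)).
Implicit Types (p q : 'S_m) (s : (m ^ 2).-tuple bool).

Definition rows_before t p : {set 'I_m} :=
  [set i | mxvec_index i (p i) \in queried_before P t].

Lemma notPERM_query_inj : injective (@query _ P).
Proof.
(* The zero matrix is an accepted input because m > 0. *)
apply: (@query_inj _ _ [tuple false | x < m ^ 2]); apply/P_notPERM.
case: (boolP (notPERM _)) => // /notPERMPn[r Er].
have := Er (Ordinal m_gt0) (r (Ordinal m_gt0)).
by rewrite tnth_mktuple eqxx.
Qed.

Lemma leq_depth : depth P <= m ^ 2.
Proof. by have := leq_card _ notPERM_query_inj; rewrite !card_ord. Qed.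

Lemma mem_queried_before (j : 'I_(depth P)) t :
  (query j \in queried_before P t) = (j < t).
Proof.
apply/imsetP/idP => [[j' + /notPERM_query_inj->]|lt_jt]; rewrite ?inE //.
by exists j; rewrite ?inE.
Qed.

Lemma eq_notPERM s s' :
  reach P s (depth P) = reach P s' (depth P) -> notPERM s = notPERM s'.
Proof. by move=> /eq_accepts eq_s; apply/idP/idP => /P_notPERM/eq_s/P_notPERM. Qed.

(* [r] is the hybrid of the early part of [p] and the late part of [q].       *)
Lemma hybrid_perm t p q : t <= depth P ->
  reach P (perm_input p) t = reach P (perm_input q) t ->
  exists r : 'S_m, {in rows_before t p, r =1 p} /\ {in ~: rows_before t q, r =1 q}.
Proof.
move=> t_le eq_t; pose Q := queried_before P t.
pose h : (m ^ 2).-tuple bool :=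
  [tuple if x \in Q then tnth (perm_input p) x else tnth (perm_input q) x | x < m ^ 2].
have : ~~ notPERM h.
  rewrite (@eq_notPERM _ (perm_input q)) ?perm_inputF //.
  apply: (@eq_reach_from _ _ _ _ t); first by rewrite t_le leqnn.
    by rewrite -eq_t; apply: eq_reach => // x xQ; rewrite tnth_mktuple xQ.
  move=> j /andP[le_tj _].
  by rewrite tnth_mktuple mem_queried_before ltnNge le_tj.
case/notPERMPn=> r Er; exists r; split=> i; rewrite !inE => iQ; apply/eqP.
  by rewrite -Er tnth_mktuple iQ tnth_perm_input.
by rewrite -Er tnth_mktuple (negPf iQ) tnth_perm_input.
Qed.

(** On a row early for p but late for q the hybrid agrees with both, so p and q put their 1 at the
    same position, which would be both queried and not queried before t. *)
Lemma rows_before_sub t p q : t <= depth P ->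
  reach P (perm_input p) t = reach P (perm_input q) t ->
  rows_before t p \subset rows_before t q.
Proof.
move=> t_le /(hybrid_perm t_le)[r [rp rq]].
apply/subsetP => i ip; apply/negPn/negP => iq.
have := rq i; rewrite in_setC iq rp // => /(_ isT) eq_pq.
by move: iq; rewrite inE -eq_pq; move: ip; rewrite inE => ->.
Qed.

Lemma reach_perm_inj t p q : t <= depth P ->
  reach P (perm_input p) t = reach P (perm_input q) t ->
  rows_before t p = rows_before t q /\
  p @: rows_before t p = q @: rows_before t q.
Proof.
move=> t_le eq_t.
have eq_rows : rows_before t p = rows_before t q.
  by apply/eqP; rewrite eqEsubset !rows_before_sub.
split=> //; have [r [rp rq]] := hybrid_perm t_le eq_t.
(* The hybrid r equals p on the early rows and q on the others; as r and q are bijections,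
   complements turn the second fact into one about images of early rows. *)
rewrite -(eq_in_imset rp) eq_rows; apply: setC_inj.
have imC (u : 'S_m) (A : {set 'I_m}) : ~: (u @: A) = u @: ~: A.
  apply/setP=> y; rewrite -[y](permKV u) in_setC !mem_imset ?in_setC //;
  exact: perm_inj.
by rewrite !imC; apply: eq_in_imset.
Qed.

Lemma rows_before0 p : rows_before 0 p = set0.
Proof.
by apply/setP=> i; rewrite !inE; apply/negbTE/imsetP => -[j]; rewrite inE.
Qed.

(** Clearing all bits that are never queried leaves the input rejected, hence a permutation matrix;
    its ones are among those of p, so none was cleared. *)
Lemma rows_before_depth p : rows_before (depth P) p = setT.
Proof.
apply/setP=> i; rewrite in_setT.
pose s : (m ^ 2).-tuple bool :=
  [tuple (x \in queried_before P (depth P)) && tnth (perm_input p) x | x < m ^ 2].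
have : ~~ notPERM s.
  rewrite (@eq_notPERM _ (perm_input p)) ?perm_inputF //.
  by apply: eq_reach => // x xQ; rewrite tnth_mktuple xQ.
case/notPERMPn=> r Er; have := Er i (r i).
rewrite eqxx tnth_mktuple tnth_perm_input => /andP[+ /eqP eq_pr].
by rewrite inE eq_pr.
Qed.

(** A level queries a single matrix position, which lies in a single row; past [depth P] nothing new
    is queried. *)
Lemma card_rows_beforeS t p : #|rows_before t.+1 p| <= #|rows_before t p|.+1.
Proof.
have [t_lt|t_ge] := ltnP t (depth P); last first.
  apply: leqW; apply/subset_leq_card/subsetP=> i; rewrite !inE.
  case/imsetP=> j _ ->; rewrite mem_queried_before; exact: leq_trans t_ge.
pose S := [set i | mxvec_index i (p i) == query (Ordinal t_lt)].
have S_le1 : #|S| <= 1.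
  apply/card_le1_eqP => i i'; rewrite !inE => /eqP <- /eqP eq_i.
  by have [] := @mxvec_index_inj m m (i', p i') (i, p i) eq_i.
rewrite -[leqRHS]addn1; apply: (@leq_trans #|rows_before t p :|: S|).
  apply/subset_leq_card/subsetP=> i; rewrite !inE.
  case/imsetP=> j; rewrite inE ltnS leq_eqVlt => /predU1P[eq_jt|lt_jt] ->.
    by rewrite orbC; apply/orP; left; apply/eqP; congr query; apply: val_inj.
  by rewrite mem_queried_before lt_jt.
by rewrite (leq_trans (leq_card_setU _ _)) // leq_add2l.
Qed.

Lemma card_rows_before_le t k : t <= depth P ->
  #|[set p | #|rows_before t p| == k]| <= 2 ^ width P * (k`! * (m - k)`!).
Proof.
move=> t_le; set A := [set p | _].
pose g p := reach P (perm_input p) t.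
have card_fiber B : #|[set p in A | g p == B]| <= k`! * (m - k)`!.
  have [->|[q]] := set_0Vmem [set p in A | g p == B]; first by rewrite cards0.
  rewrite !inE => /andP[/eqP card_q /eqP gq].
  have -> : m - k = #|~: rows_before t q|.
    by rewrite -card_q -[RHS](addKn #|rows_before t q|) cardsC card_ord.
  rewrite -{1}card_q.
  apply: leq_trans (card_perm_imset_le (rows_before t q) (q @: rows_before t q)).
  apply/subset_leq_card/subsetP=> p; rewrite !inE => /andP[_ /eqP].
  by rewrite -gq => /(reach_perm_inj t_le)[-> ->].
apply: leq_trans (card_fibers_le card_fiber) _.
by rewrite leq_mul2r card_reach_sets ?orbT.
Qed.

Lemma bin_le_width k : 0 < k <= m -> 'C(m, k) <= m ^ 2 * 2 ^ width P.
Proof.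
case/andP=> k_gt0 k_le.
have fact_gt0 : 0 < k`! * (m - k)`! by rewrite muln_gt0 !fact_gt0.
(* Multiplying by k! (m - k)! turns the binomial into m!, the number of permutations to be
   covered. *)
rewrite -(leq_pmul2r fact_gt0) bin_fact // -mulnA.
have -> : m`! = #|[set: 'S_m]| by rewrite cardsT card_Sn.
(* Since k > 0, level 0 is never the one found; the shift by one leaves [depth P] levels, at most
   [m ^ 2]. *)
pose F (t : 'I_(depth P)) := [set p | #|rows_before t.+1 p| == k].
apply: (@leq_trans #|\bigcup_t F t|); last first.
  apply: leq_trans (card_bigcup_le _) _ => [t|]; first exact: card_rows_before_le.
  by rewrite card_ord leq_mul2r leq_depth orbT.
apply/subset_leq_card/subsetP=> p _.
have [|t t_le card_t] := @discrete_ivt (fun t => #|rows_before t p|) k (depth P)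
  (card_rows_beforeS ^~ p).
  by rewrite rows_before0 cards0 rows_before_depth cardsT card_ord.
case: t => [|t] in t_le card_t *.
  by move: k_gt0; rewrite -card_t rows_before0 cards0.
by apply/bigcupP; exists (Ordinal t_le); rewrite ?inE ?card_t.
Qed.

Lemma exp_le_width : 4 ^ m <= 4 * m ^ 5 * 4 ^ width P.
Proof.
(* For m = 1, [m./2] is 0, which [bin_le_width] excludes. *)
have [m_le1|m_gt1] := leqP m 1.
  move: (width P) => w; have -> : m = 1 by lia.
  by rewrite exp1n muln1 expn1 leq_pmulr ?expn_gt0.
have := @bin_le_width m./2 ltac:(lia) => bin_le.
apply: leq_trans (half_bin_lower m_gt0) _.
apply: (@leq_trans (4 * m * (m ^ 2 * 2 ^ width P) ^ 2)).
  by rewrite leq_pmul2l ?leq_exp2r // muln_gt0.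
have -> : 4 ^ width P = (2 ^ width P) ^ 2 by rewrite -expnM mulnC expnM.
by apply: eq_leq; ring.
Qed.

End NotPERM.

(** * Passage to logarithms *)

Theorem theorem3 (R : realType) (m : nat) (m_gt0 : (0 < m)%N)
    (P : nobdd (m ^ 2)) (P_notPERM : computes P (@notPERM m)) :
  let n : R := ((m ^ 2)%N%:R)%R in
  (Num.sqrt n - 5 / 4 * log2 n - 1 <= (width P)%:R)%R.
Proof.
cbv zeta; have := exp_le_width m_gt0 P_notPERM; move: (width P) => w le_4.
have m_pos : (0 < m%:R :> R)%R by rewrite ltr0n.
have ln2_pos : (0 < ln 2 :> R)%R by rewrite ln_gt0 // ltr1n.
have ln4 : ln 4 = (2 * ln 2 :> R)%R.
  by rewrite -[4%R]/((2 * 2)%N%:R)%R natrM lnM ?posrE ?ltr0n //; ring.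
have le_ln : (m%:R * (2 * ln 2) <= 2 * ln 2 + 5 * ln m%:R + w%:R * (2 * ln 2) :> R)%R.
  have : ((4 : R) ^+ m <= 4 * m%:R ^+ 5 * 4 ^+ w)%R.
    by rewrite -!natrX -!natrM ler_nat.
  rewrite -ler_ln ?posrE ?mulr_gt0 ?exprn_gt0 ?ltr0n //.
  rewrite !lnM ?posrE ?mulr_gt0 ?exprn_gt0 ?ltr0n //.
  by rewrite !lnXn ?ltr0n // ln4 -(mulr_natl _ m) -(mulr_natl _ w); lra.
(* Here sqrt n = m and ln n = 2 ln m, so 5/4 log2 n is 5/2 log2 m, which is what [le_ln] yields
   after division by 2 ln 2. *)
rewrite natrX sqrtr_sqr ger0_norm ?ler0n // /log2 lnXn // -(mulr_natl (ln m%:R)).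
rewrite -(ler_pM2r ln2_pos) !mulrBl mul1r.
have -> : (5 / 4 * (2%:R * ln m%:R / ln 2) * ln 2 = 5 / 2 * ln m%:R :> R)%R.
  by field; rewrite gt_eqF.
by lra.
Qed.
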